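(* Let $\mathcal X$ be a discrete instance space with unweighted improvement graph $G=(\mathcal X,E)$ having a self-loop at every node, let $\mathcal Y=\{z_1,\dots,z_k\}$ be a finite label set with preference order $z_1<z_2<\dots<z_k$, and let $\mathcal H\subseteq\mathcal Y^{\mathcal X}$ be a nonempty hypothesis class. In the realizable multiclass online learning with improvement game with full feedback, the optimal number of mistakes achieved by deterministic learners equals $\mathrm{ILdim}(\mathcal H)$ (the multiclass improvement Littlestone dimension). Furthermore, this optimal number is achieved by the Multiclass ISOA algorithm.
   Context: Improvement graph: $G=(\mathcal X,E)$ is a directed graph; $\Delta(x)=\{v:(x,v)\in E\}$, and $x\in\Delta(x)$ for all $x$. Best response: given $h:\mathcal X\to\mathcal Y$ and $x$, if no $v\in\Delta(x)$ has $h(v)>h(x)$, the agent stays at $x$; otherwise it moves to some $v\in\Delta(x)$ for which $h(v)$ is the most preferred label among $\{h(u):u\in\Delta(x)\}$ (ties broken adversarially). Game: at each round $t=1,2,\dots$: the environment presents $x^{(t)}$; the learner, as a deterministic function of everything observed so far, implements $h^{(t)}:\mathcal X\to\mathcal Y$; the agent best responds, ending at $v^{(t)}\in\Delta(x^{(t)})$; the environment selects $y^{(t)}\in\mathcal Y$; the learner makes a mistake iff $h^{(t)}(v^{(t)})\neq y^{(t)}$. Full feedback: the learner is told whether it made a mistake, and upon a mistake it receives $v^{(t)}$ and $y^{(t)}$. A run is realizable by $\mathcal H$ if there is $h^*\in\mathcal H$ with $h^*(v^{(t)})=y^{(t)}$ for all $t$; only realizable runs are considered. The optimal number of mistakes is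 the infimum over deterministic learners of the supremum, over realizable runs, of the number of mistakes (possibly $\infty$). Multiclass ILT: a rooted tree whose nodes are labeled by elements of $\mathcal X$, in which each internal node labeled $x$ has exactly the following outgoing edges: two edges labeled $(x,y_1)$ and $(x,y_2)$ for some $y_1\ne y_2$ in $\mathcal Y$; and for each $v\in\Delta(x)\setminus\{x\}$, either one edge labeled $(v,z_1)$, or two edges labeled $(v,y_3)$ and $(v,y_4)$ for some $y_3\neq y_4$ in $\mathcal Y\setminus\{z_1\}$ (choices may depend on the node and on $v$). Depth is the length of the shortest root-to-leaf branch. A tree is shattered by $\mathcal H$ if for every branch with edge labels $(u_1,y_1),(u_2,y_2),\dots$ there is $h\in\mathcal H$ with $h(u_i)=y_i$ for all $i$. $\mathrm{ILdim}(\mathcal H)$ is the maximum depth of a multiclass ILT shattered by $\mathcal H$ ($\infty$ if unbounded; a single-node tree has depth $0$); $\mathrm{ILdim}(\emptyset)=-1$ by convention. For $\mathcal V\subseteq\mathcal H$, $\mathcal V_{x,y}=\{h\in\mathcal V:h(x)=y\}$. Multiclass ISOA: initialize $\mathcal V=\mathcal H$. At round $t$, upon receiving $x^{(t)}$, define $h^{(t)}$ on $\Delta(x^{(t)})$ (its values elsewhere are irrelevant) by the first applicable rule: (i) if some $x'\in\Delta(x^{(t)})$ has $\max_y\mathrm{ILdim}(\mathcal V_{x',y})<\mathrm{ILdim}(\mathcal V)$, set $h^{(t)}(x')=z_k$ and $h^{(t)}(v)=z_1$ for all other $v\in\Delta(x^{(t)})$; (ii) else if $\arg\max_y\mathrm{ILdim}(\mathcal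 V_{x^{(t)},y})$ is a unique label $y$, set $h^{(t)}(x^{(t)})=y$ and $h^{(t)}(v)=z_1$ for all other $v\in\Delta(x^{(t)})$; (iii) else take $x'\in\Delta(x^{(t)})$ for which $\arg\max_y\mathrm{ILdim}(\mathcal V_{x',y})$ is a unique label $y$ and $y\ne z_1$, and set $h^{(t)}(x')=y$, $h^{(t)}(v)=z_1$ for all other $v\in\Delta(x^{(t)})$. (If no rule applies, which is only relevant when $\mathrm{ILdim}(\mathcal V)=\infty$, the hypothesis is arbitrary.) If a mistake is made, replace $\mathcal V$ by $\mathcal V_{v^{(t)},y^{(t)}}$. *)

(* Defs.v *)
From mathcomp Require Import all_boot all_order all_algebra.
From mathcomp Require Import mathcomp_extra boolp classical_sets constructive_ereal.

Set Implicit Arguments.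
Unset Strict Implicit.
Unset Printing Implicit Defensive.

Local Open Scope classical_set_scope.

(* Conventions.
   - The improvement graph is given by its edge set [E : set (X * X)].
   - The label set is any nonempty finite totally ordered set; its least
     element [\bot] is z_1 and its greatest element [\top] is z_k.
   - Dimensions and numbers of mistakes live in [\bar int]: they range over
     {-1} + nat + {+oo} and nat + {+oo} respectively.  The first argument of
     [supremum] / [infimum] is the value at the empty set. *)

Definition nbhd (X : Type) (E : set (X * X)) (x : X) : set X :=
  [set v | E (x, v)].

Definition restrict (X Y : Type) (V : set (X -> Y)) (x : X) (y : Y) :
  set (X -> Y) := [set h | V h /\ h x = y].

Section Tree.
Context (X : Type) (d : Order.disp_t) (Y : finTBOrderType d).

(* [Node x out c]: internal node labeled [x] whose outgoing edges are the pairs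
   (u, y) with [out u y], the edge labeled (u, y) leading to [c u y]; the values
   of [c] at other pairs are not part of the tree.  Edge labels at a node of an
   improvement tree are pairwise distinct, so a set of labels loses nothing.
   Labels of leaves are never used and are omitted. *)
Inductive tree : Type :=
| Leaf
| Node (x : X) (out : X -> set Y) (c : X -> Y -> tree).

Inductive is_ilt (E : set (X * X)) : tree -> Prop :=
| ilt_leaf : is_ilt E Leaf
| ilt_node x out c :
    (exists y1 y2, y1 <> y2 /\ out x = [set y1; y2]) ->
    (forall v, nbhd E x v -> v <> x ->
       out v = [set (\bot)%O] \/
       (exists y3 y4, [/\ y3 <> (\bot)%O, y4 <> (\bot)%O, y3 <> y4
                        & out v = [set y3; y4]])) ->
    (forall v, ~ nbhd E x v -> v <> x -> out v = set0) ->
    (forall u y, out u y -> is_ilt E (c u y)) ->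
    is_ilt E (Node x out c).

(* [branch t s]: [s] lists the edge labels of a root-to-leaf branch of [t]. *)
Inductive branch : tree -> seq (X * Y) -> Prop :=
| branch_leaf : branch Leaf [::]
| branch_node x out c u y s :
    out u y -> branch (c u y) s -> branch (Node x out c) ((u, y) :: s).

Definition is_depth (t : tree) (n : nat) : Prop :=
  (exists2 s, branch t s & size s = n) /\
  (forall s, branch t s -> (n <= size s)%N).

Definition shattered (V : set (X -> Y)) (t : tree) : Prop :=
  forall s, branch t s -> exists2 h, V h & all (fun e => h e.1 == e.2) s.

(* Any nonempty [V] shatters the tree [Leaf], of depth 0, and the empty class
   shatters nothing, so that its dimension is the default value -1. *)
Definition ILdim (E : set (X * X)) (V : set (X -> Y)) : \bar int :=
  supremum (-1)%:E
    [set n%:Z%:E | n in [set n : nat |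
       exists t, [/\ is_ilt E t, shattered V t & is_depth t n]]].

End Tree.

Section Game.
Context (X : Type) (d : Order.disp_t) (Y : finTBOrderType d).
Variable E : set (X * X).

Definition best_response (h : X -> Y) (x v : X) : Prop :=
  ((~ exists2 u, nbhd E x u & (h x < h u)%O) -> v = x) /\
  ((exists2 u, nbhd E x u & (h x < h u)%O) ->
     nbhd E x v /\ forall u, nbhd E x u -> (h u <= h v)%O).

(* [None]: no mistake; [Some (v, y)]: a mistake, revealing the agent's final
   position and the true label. *)
Definition feedback : Type := option (X * Y).

(* Past rounds, oldest first: the instance presented and the feedback.  The
   hypotheses implemented earlier are determined by these data. *)
Definition history : Type := seq (X * feedback).

Definition learner : Type := history -> X -> (X -> Y).

(* Rounds are numbered from 0. *)
Record play : Type := Play {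
  instance : nat -> X;
  position : nat -> X;
  label : nat -> Y }.

Definition give_feedback (h : X -> Y) (v : X) (y : Y) : feedback :=
  if h v == y then None else Some (v, y).

(* The history before round [t]. *)
Fixpoint past (L : learner) (p : play) (t : nat) : history :=
  if t is t'.+1 then
    rcons (past L p t')
      (instance p t', give_feedback (L (past L p t') (instance p t'))
                                    (position p t') (label p t'))
  else [::].

Definition hyp (L : learner) (p : play) (t : nat) : X -> Y :=
  L (past L p t) (instance p t).

Definition legal (L : learner) (p : play) : Prop :=
  forall t, best_response (hyp L p t) (instance p t) (position p t).

Definition realizable (H : set (X -> Y)) (p : play) : Prop :=
  exists2 h, H h & forall t, h (position p t) = label p t.

Definition mistake (L : learner) (p : play) (t : nat) : bool :=
  hyp L p t (position p t) != label p t.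

Definition nb_mistakes (L : learner) (p : play) : \bar int :=
  supremum 0%E [set (\sum_(t < T) mistake L p t)%N%:Z%:E | T in [set: nat]].

Definition worst_case (H : set (X -> Y)) (L : learner) : \bar int :=
  supremum 0%E
    [set nb_mistakes L p | p in [set p | legal L p /\ realizable H p]].

Definition optimal_mistakes (H : set (X -> Y)) : \bar int :=
  infimum +oo%E [set worst_case H L | L in [set: learner]].

Definition max_dim (V : set (X -> Y)) (x : X) : \bar int :=
  \big[Order.max/-oo%E]_(y : Y) ILdim E (restrict V x y).

Definition argmax_dim (V : set (X -> Y)) (x : X) : set Y :=
  [set y | ILdim E (restrict V x y) = max_dim V x].

(* [h] takes the value [y] at [x'] and z_1 elsewhere on the neighborhood of
   [x]. *)
Definition spike (x x' : X) (y : Y) (h : X -> Y) : Prop :=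
  h x' = y /\ forall v, nbhd E x v -> v <> x' -> h v = (\bot)%O.

Definition rule1 (V : set (X -> Y)) (x : X) : set X :=
  [set x' | nbhd E x x' /\ (max_dim V x' < ILdim E V)%E].

Definition rule2 (V : set (X -> Y)) (x : X) : set Y :=
  [set y | argmax_dim V x = [set y]].

Definition rule3 (V : set (X -> Y)) (x : X) : set (X * Y) :=
  [set c | [/\ nbhd E x c.1, argmax_dim V c.1 = [set c.2] & c.2 <> (\bot)%O]].

(* [h] is prescribed by the first applicable rule, for some choice of x'; it is
   unconstrained when no rule applies. *)
Definition ISOA_step (V : set (X -> Y)) (x : X) (h : X -> Y) : Prop :=
  [/\ rule1 V x !=set0 ->
        exists2 x', rule1 V x x' & spike x x' (\top)%O h,
      rule1 V x = set0 -> rule2 V x !=set0 ->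
        exists2 y, rule2 V x y & spike x x y h
    & rule1 V x = set0 -> rule2 V x = set0 -> rule3 V x !=set0 ->
        exists2 c, rule3 V x c & spike x c.1 c.2 h].

Definition version_space (H : set (X -> Y)) (r : history) : set (X -> Y) :=
  foldl (fun V o => if o.2 is Some (v, y) then restrict V v y else V) H r.

(* [L] is an implementation of the Multiclass ISOA on [H]; implementations
   differ by the choices of x', the values off the neighborhood of the current
   instance, and the hypotheses used when no rule applies. *)
Definition multiclass_ISOA (H : set (X -> Y)) (L : learner) : Prop :=
  forall (r : history) (x : X), ISOA_step (version_space H r) x (L r x).

End Game.

(* Main.v *)
(* Lower bound: at each node of a shattered tree, the agent's response [v] to the
   learner's hypothesis [g] always has an outgoing edge (v, y) with g v <> y,
   since an agent that moves ends at a label above z_1; so every learner errs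
   along a whole branch.  Upper bound: against a spike hypothesis the agent's
   position is forced, so each mistake of the ISOA restricts the version space to
   a class of smaller dimension; a node at which no rule applies would be the
   root of a shattered tree that is too deep. *)

Require Import Defs.
From mathcomp Require Import all_boot all_order all_algebra.
From mathcomp Require Import mathcomp_extra boolp classical_sets constructive_ereal.
From mathcomp Require Import zify.

Set Implicit Arguments.
Unset Strict Implicit.
Unset Printing Implicit Defensive.

Import Order.TTheory GRing.Theory Num.Theory.
Local Open Scope classical_set_scope.

(** * Suprema and infima in the extended integers *)

Section ExtendedIntegers.
Local Open Scope ereal_scope.
Implicit Types (A : set (\bar int)) (u : \bar int).

(** With an integer bound [b] and a finite element, the supremum is a maximum: the element at least
    distance below [b]. Otherwise it is [+oo] or [-oo]. *)
Lemma supremums_ereal_int_neq0 A : supremums A !=set0.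
Proof.
have [[b Ab]|nub] := pselect (exists b : int, ubound A b%:E); last first.
  exists +oo; split=> [x _|[r|//|] Au]; first by rewrite leey.
    by case: nub; exists r.
  by case: nub; exists 0%R => x /Au; rewrite leeNy_eq => /eqP ->; rewrite leNye.
have [[a Aa]|nA] := pselect (exists a : int, A a%:E); last first.
  exists -oo; split=> [[r|/=|//] Ax|u _]; last by rewrite leNye.
    by case: nA; exists r.
  by move/Ab: Ax; rewrite leye_eq.
have exk : exists k : nat, `[< A (b - k%:Z)%:E >].
  have := Ab _ Aa; rewrite lee_fin => ab.
  by exists `|b - a|%N; apply/asboolP; rewrite (_ : b - _ = a)%R //; lia.
case: (ex_minnP exk) => k /asboolP Ak kmin.
exists (b - k%:Z)%:E; split=> [[r||] Ax|u]; last by move=> /(_ _ Ak).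
- have := Ab _ Ax; rewrite !lee_fin => rb; have : (k <= `|b - r|)%N; last by lia.
  by apply: kmin; apply/asboolP; rewrite (_ : b - _ = r)%R //; lia.
- by move/Ab: Ax; rewrite leye_eq.
- by rewrite leNye.
Qed.

Lemma le_supremum x0 A u : A u -> u <= supremum x0 A.
Proof. by apply: ge_supremum_Nmem; exact: supremums_ereal_int_neq0. Qed.

Lemma supremum_le x0 A u : x0 <= u -> ubound A u -> supremum x0 A <= u.
Proof.
move=> x0u Au; rewrite /supremum; case: ifP => // _.
by have [_ /(_ _ Au)] := xgetPex x0 (supremums_ereal_int_neq0 A).
Qed.

Lemma infimum_min x0 A u : A u -> lbound A u -> infimum x0 A = u.
Proof.
move=> Au lAu; have infu : infimums A u by split=> // w /(_ _ Au).
rewrite /infimum; case: ifP => [/eqP A0|_]; first by rewrite A0 in Au.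
exact: (is_subset1_infimums (xgetI x0 infu) infu).
Qed.

(** By discreteness: if [n] were missing from [A], then [n - 1] would still bound [A], and also the
    default value -1 since [n] is nonnegative. *)
Lemma supremum_nat_attained (A : set nat) n :
  supremum (-1)%:E [set k%:Z%:E | k in A] = n%:Z%:E -> A n.
Proof.
set B := (image _ _) => supn; apply: contrapT => An.
suff : supremum (-1)%:E B <= (n%:Z - 1)%:E by rewrite supn lee_fin; lia.
apply: supremum_le => [|_ [k Ak <-]]; first by rewrite lee_fin; lia.
have := le_supremum (-1)%:E (imageP (fun k : nat => k%:Z%:E) Ak).
rewrite supn !lee_fin => kn.
have : k <> n by move=> kn'; rewrite kn' in Ak.
lia.
Qed.

End ExtendedIntegers.

(** * The dimension, and the gluing of shattered trees at a root *)

Section Dimension.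
Context (X : Type) (d : Order.disp_t) (Y : finTBOrderType d) (E : set (X * X)).
Implicit Types (V W : set (X -> Y)) (t : tree X Y).
Local Open Scope ereal_scope.

Definition shatters_depth V (n : nat) : Prop :=
  exists t, [/\ is_ilt E t, shattered V t & is_depth t n].

Lemma shatters_depth_le_ILdim V n : shatters_depth V n -> n%:Z%:E <= ILdim E V.
Proof. by move=> Vn; apply: le_supremum; exists n. Qed.

Lemma ILdim_shatters_depth V n : ILdim E V = n%:Z%:E -> shatters_depth V n.
Proof. exact: supremum_nat_attained. Qed.

Lemma shattered_subset V W t : V `<=` W -> shattered V t -> shattered W t.
Proof. by move=> VW Vt s /Vt [h /VW]; exists h. Qed.

Lemma ILdim_ge0 V : V !=set0 -> 0 <= ILdim E V.
Proof.
move=> [h Vh]; apply: (@shatters_depth_le_ILdim V 0).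
exists (@Leaf X d Y); split; first exact: ilt_leaf.
  by move=> s sb; exists h => //; inversion sb.
by split=> //; exists [::] => //; exact: branch_leaf.
Qed.

Lemma ILdim_nat V : V !=set0 ->
  ILdim E V = +oo \/ exists n : nat, ILdim E V = n%:Z%:E.
Proof.
move=> /ILdim_ge0; case: (ILdim E V) => [r|_|//]; last by left.
by rewrite lee_fin => r0; right; exists `|r|%N; congr EFin; lia.
Qed.

Lemma ILdim_geN1 V : (-1)%:E <= ILdim E V.
Proof.
rewrite /ILdim; set B := (image _ _).
have [->|/set0P [_ [n Bn _]]] := eqVneq B set0; first by rewrite supremum0.
apply: (@le_trans _ _ n%:Z%:E); first by rewrite lee_fin; lia.
by apply: le_supremum; exists n.
Qed.

Lemma ILdim_subset V W : V `<=` W -> ILdim E V <= ILdim E W.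
Proof.
move=> VW; apply: supremum_le; first exact: ILdim_geN1.
move=> _ [n [t [tE Vt tn]] <-]; apply: shatters_depth_le_ILdim.
by exists t; split=> //; exact: shattered_subset VW Vt.
Qed.

Lemma restrict_subset V x y : restrict V x y `<=` V.
Proof. by move=> h []. Qed.

Lemma le_max_dim V x y : ILdim E (restrict V x y) <= max_dim E V x.
Proof. exact: le_bigmax. Qed.

Lemma max_dim_le V x : max_dim E V x <= ILdim E V.
Proof.
apply: bigmax_le => [|y _]; first exact: leNye.
by apply: ILdim_subset; exact: restrict_subset.
Qed.

Lemma argmax_dim_neq0 V x : argmax_dim E V x !=set0.
Proof.
have [||y _ yE] := @eq_bigmax _ _ _ -oo (\bot)%O predT
  (fun y : Y => ILdim E (restrict V x y)).
- by [].
- by move=> y _; exact: leNye.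
by exists y; rewrite /argmax_dim /= /max_dim yE.
Qed.

Lemma argmax_dim_two V x : (forall y, argmax_dim E V x <> [set y]) ->
  exists y1 y2, [/\ y1 <> y2, argmax_dim E V x y1 & argmax_dim E V x y2].
Proof.
move=> nuniq; have [y1 y1max] := argmax_dim_neq0 V x.
apply: contrapT => none; apply: (nuniq y1); apply/seteqP; split=> [y2 y2max|_ -> //].
by apply: contrapT => /= ne; apply: none; exists y1, y2; split=> // /esym.
Qed.

(** The conditions of [ilt_node] on the edge labels, separated from the subtrees. *)
Definition node_labels (x : X) (out : X -> set Y) : Prop :=
  [/\ exists y1 y2, y1 <> y2 /\ out x = [set y1; y2],
      forall v, nbhd E x v -> v <> x ->
        out v = [set (\bot)%O] \/
        (exists y3 y4, [/\ y3 <> (\bot)%O, y4 <> (\bot)%O, y3 <> y4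
                         & out v = [set y3; y4]])
    & forall v, ~ nbhd E x v -> v <> x -> out v = set0].

Lemma shatters_depth_node V x (out : X -> set Y) n :
  node_labels x out ->
  (forall u y, out u y -> shatters_depth (restrict V u y) n) ->
  shatters_depth V n.+1.
Proof.
move=> [outx outv out0] sub.
(* One subtree is chosen per edge, with a dummy leaf at pairs that label no edge. *)
have /choice [c cP] (uy : X * Y) : exists t, out uy.1 uy.2 ->
    [/\ is_ilt E t, shattered (restrict V uy.1 uy.2) t & is_depth t n].
  have [/sub [t tP]|nout] := pselect (out uy.1 uy.2); first by exists t.
  by exists (@Leaf X d Y).
exists (Node x out (fun u y => c (u, y))); split.
- by apply: ilt_node => // u y /(cP (u, y)) [].
- move=> s sb; inversion sb as [|x' out' c' u y s' uy s'b]; subst.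
  have [_ /(_ _ s'b) [h [Vh hu] hs'] _] := cP (u, y) uy.
  by exists h => //=; rewrite hu eqxx.
split.
(* A branch of length exactly [n.+1] must exist; the edges at [x] itself ensure that the root has a
   child. *)
- have [y1 [y2 [_ outxE]]] := outx.
  have xy1 : out x y1 by rewrite outxE; left.
  have [_ _ [[s sb sn] _]] := cP (x, y1) xy1.
  by exists ((x, y1) :: s); [exact: branch_node | rewrite /= sn].
move=> s sb; inversion sb as [|x' out' c' u y s' uy s'b]; subst.
by have [_ _ [_ /(_ _ s'b)]] := cP (u, y) uy.
Qed.

(* If the rules were all inapplicable, every node of the neighborhood would have
   enough labels keeping the dimension at [n] to label the edges leaving a root,
   and shattered trees of depth [n] below it give one of depth [n.+1]. *)
Lemma ISOA_rule_applies V x n : nbhd E x x -> ILdim E V = n%:Z%:E ->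
  rule1 E V x = set0 -> rule2 E V x = set0 -> rule3 E V x !=set0.
Proof.
move=> Exx Vn no1 no2; apply: contrapT => no3.
have maxn v : nbhd E x v -> max_dim E V v = n%:Z%:E.
  move=> xv; apply/eqP; rewrite eq_le -{1}Vn max_dim_le leNgt -Vn.
  by apply/negP => lt; have : rule1 E V x v by []; rewrite no1.
(* All labels are taken among the maximizers: two at [x] since rule 2 fails; at another neighbor,
   z_1 alone if it is a maximizer, and otherwise two labels above z_1, since rule 3 fails. *)
have /choice [out outP] (v : X) : exists o : set Y,
  [/\ v = x -> exists y1 y2, y1 <> y2 /\ o = [set y1; y2],
      nbhd E x v -> v <> x ->
        o = [set (\bot)%O] \/
        (exists y3 y4, [/\ y3 <> (\bot)%O, y4 <> (\bot)%O, y3 <> y4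
                         & o = [set y3; y4]]),
      ~ nbhd E x v -> v <> x -> o = set0
    & forall y, o y -> nbhd E x v /\ argmax_dim E V v y].
  have [->|vx] := pselect (v = x).
    have [|y1 [y2 [y12 m1 m2]]] := @argmax_dim_two V x.
      by move=> y xy; have : rule2 E V x y by []; rewrite no2.
    by exists [set y1; y2]; split=> //; [exists y1, y2 | move=> y [] ->].
  have [xv|nxv] := pselect (nbhd E x v); last by exists set0; split.
  have [b|nb] := pselect (argmax_dim E V v (\bot)%O).
    by exists [set (\bot)%O]; split=> //; [left | move=> y ->].
  have [|y1 [y2 [y12 m1 m2]]] := @argmax_dim_two V v.
    move=> y vy; apply: no3; exists (v, y); split=> //= yb.
    by apply: nb; rewrite vy yb.
  exists [set y1; y2]; split=> //; last by move=> y [] ->.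
  by right; exists y1, y2; split=> // yb; apply: nb; rewrite -yb.
have : shatters_depth V n.+1.
  apply: (@shatters_depth_node _ x out).
    split=> [|v xv vx|v nxv vx]; [by have [/(_ erefl)] := outP x| |].
      by have [_ /(_ xv vx)] := outP v.
    by have [_ _ /(_ nxv vx)] := outP v.
  move=> u y uy; apply: ILdim_shatters_depth.
  by have [_ _ _ /(_ y uy) [xu ->]] := outP u; rewrite maxn.
by move/shatters_depth_le_ILdim; rewrite Vn lee_fin; lia.
Qed.

End Dimension.

(** * Best responses and a single round of the ISOA *)

Section Agent.
Context (X : Type) (d : Order.disp_t) (Y : finTBOrderType d) (E : set (X * X)).
Hypothesis Exx : forall x, E (x, x).
Implicit Types (V : set (X -> Y)) (h : X -> Y).

(** The neighborhood may be infinite, so the maximum is taken over the finite set of labels attained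
    on it. *)
Lemma best_response_exists h x : exists v, best_response E h x v.
Proof.
have [better|nbetter] := pselect (exists2 u, nbhd E x u & (h x < h u)%O); last first.
  by exists x; split.
have hx : `[< exists2 u, nbhd E x u & h u = h x >].
  by apply/asboolP; exists x => //; exact: Exx.
case: (@Order.TotalTheory.arg_maxP _ _ _ _
  (fun y => `[< exists2 u, nbhd E x u & h u = y >]) id hx).
move=> y /asboolP [v xv <-] vmax; exists v; split=> // _; split=> // u xu.
by apply: vmax; apply/asboolP; exists u.
Qed.

(** An agent never moves to a z_1 label, and does not stay at one while [x'] carries a better label.
    The case [x' = x] is separate because rule 2 may prescribe z_1 there. *)
Lemma best_response_spike h x x' v y : nbhd E x x' -> spike E x x' y h ->
  y <> (\bot)%O \/ x' = x -> best_response E h x v -> v = x'.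
Proof.
move=> xx' [hx' hbot] yx [stay move_]; apply: contrapT => vx'.
have [better|nbetter] := pselect (exists2 u, nbhd E x u & (h x < h u)%O).
  have [xv vmax] := move_ better; case: better => u /vmax.
  by rewrite (hbot _ xv vx') lex0 => /eqP ->; rewrite ltx0.
have vx := stay nbetter; rewrite vx in vx'.
case: yx => [ybot|]; last by move/esym.
apply: nbetter; exists x' => //; rewrite hx' (hbot _ (Exx x) vx') lt0x.
exact/eqP.
Qed.

(** Under rule 1 every label at the forced position lowers the dimension; under rules 2 and 3 the
    learner predicts the unique maximizer, so the true label of a mistake is not one. *)
Lemma ISOA_mistake_lt V x h v y n : ILdim E V = n%:Z%:E ->
  ISOA_step E V x h -> best_response E h x v -> h v != y ->
  (ILdim E (restrict V v y) < ILdim E V)%E.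
Proof.
move=> Vn [step1 step2 step3] br mis.
have unique_lt u z : argmax_dim E V u = [set z] -> z <> y ->
    (ILdim E (restrict V u y) < ILdim E V)%E.
  move=> uz zy; apply: (lt_le_trans _ (max_dim_le E V u)).
  rewrite lt_neqAle le_max_dim andbT; apply/negP => /eqP uy.
  have : argmax_dim E V u y by []; by rewrite uz => /esym.
have [r1|] := eqVneq (rule1 E V x) set0; last first.
  move/set0P/step1 => [x' [xx' lt] sp].
  have -> : v = x'.
    apply: best_response_spike xx' sp _ br; left => tb.
    (* If z_k = z_1 there is only one label, and no mistake can occur. *)
    have all_bot (z : Y) : z = (\bot)%O.
      by apply/eqP; rewrite -lex0 -tb lex1.
    by move: mis; rewrite (all_bot (h v)) (all_bot y) eqxx.
  exact: le_lt_trans (le_max_dim _ _ _ _) lt.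
have [r2|] := eqVneq (rule2 E V x) set0; last first.
  move/set0P/(step2 r1) => [z xz sp].
  have vx : v = x by apply: best_response_spike (Exx x) sp _ br; right.
  rewrite vx in mis *; apply: unique_lt xz _.
  by case: sp mis => -> _ /eqP.
have [[x' z] /= [xx' x'z zb] sp] :=
  step3 r1 r2 (ISOA_rule_applies (Exx x) Vn r1 r2).
have vx : v = x' by apply: best_response_spike xx' sp _ br; left.
rewrite vx in mis *; apply: unique_lt x'z _.
by case: sp mis => /= -> _ /eqP.
Qed.

Lemma spike_exists x x' (y : Y) : exists h, spike E x x' y h.
Proof.
exists (fun v => if pselect (v = x') then y else (\bot)%O); split=> [|v _ vx'].
  by case: pselect.
by case: pselect.
Qed.

Lemma multiclass_ISOA_exists (H : set (X -> Y)) :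
  exists L : learner X Y, multiclass_ISOA E H L.
Proof.
suff /choice [f fP] : forall rx : history X Y * X,
    exists h, ISOA_step E (version_space H rx.1) rx.2 h.
  by exists (fun r x => f (r, x)) => r x; exact: fP (r, x).
move=> [r x] /=; move: (version_space H r) => V.
have [r1|/set0P [x' x'P]] := eqVneq (rule1 E V x) set0; last first.
  have [h hP] := spike_exists x x' (\top)%O.
  by exists h; split=> [_|r1|r1]; [exists x' | move: x'P; rewrite r1..].
have [r2|/set0P [y yP]] := eqVneq (rule2 E V x) set0; last first.
  have [h hP] := spike_exists x x y.
  exists h; split=> [|_ _|_ r2]; first by rewrite r1 => -[].
    by exists y.
  by move: yP; rewrite r2.
have [r3|/set0P [c cP]] := eqVneq (rule3 E V x) set0; last first.
  have [h hP] := spike_exists x c.1 c.2.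
  exists h; split=> [|_|_ _ _]; [by rewrite r1 => -[] | by rewrite r2 => -[]|].
  by exists c.
exists (fun=> (\bot)%O); split.
- by rewrite r1 => -[].
- by rewrite r2 => _ [].
by rewrite r3 => _ _ [].
Qed.

(** * Mistake bound for the ISOA *)

Lemma version_space_rcons (H : set (X -> Y)) r x f :
  version_space H (rcons r (x, f)) =
  if f is Some (v, y) then restrict (version_space H r) v y
  else version_space H r.
Proof. by rewrite /version_space foldl_rcons. Qed.

Lemma ISOA_mistakes_le (H : set (X -> Y)) L p n T :
  multiclass_ISOA E H L -> ILdim E H = n%:Z%:E -> legal E L p ->
  realizable H p -> (\sum_(t < T) mistake L p t <= n)%N.
Proof.
move=> isoa Hn leg [h Hh hp].
(* Potential argument: the dimension [m] of the version space plus the mistakes so far stays at most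
   [n]. The target [h] is never discarded, which keeps the dimension from dropping to -1. *)
suff [m [Vm mn _]] : exists m : nat,
    [/\ ILdim E (version_space H (past L p T)) = m%:Z%:E,
        (m + \sum_(t < T) mistake L p t <= n)%N
      & version_space H (past L p T) h].
  exact: leq_trans (leq_addl _ _) mn.
elim: T => [|T [m [Vm mn Vh]]]; first by exists n; rewrite big_ord0 addn0.
rewrite big_ord_recr /= version_space_rcons /give_feedback /mistake.
rewrite -/(hyp L p T).
set V := version_space H (past L p T) in Vm Vh *.
case: eqP => [ok|/eqP mis] /=; first by exists m; rewrite addn0.
have V'h : restrict V (position p T) (label p T) h by split.
have lt := ISOA_mistake_lt Vm (isoa _ _) (leg T) mis.
have [V'oo|[m' V'm']] := @ILdim_nat _ _ _ E _ (ex_intro _ h V'h).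
  by move: lt; rewrite -/V V'oo Vm.
exists m'; split=> //; move: lt; rewrite -/V V'm' Vm lte_fin ltz_nat => m'm.
by rewrite addn1 addnS -addSn; apply: leq_trans mn; rewrite leq_add2r.
Qed.

Lemma worst_case_ISOA_le (H : set (X -> Y)) L :
  H !=set0 -> multiclass_ISOA E H L -> (worst_case E H L <= ILdim E H)%E.
Proof.
move=> H0 isoa.
have [->|[n Hn]] := @ILdim_nat _ _ _ E _ H0; first exact: leey.
rewrite Hn; apply: supremum_le => // _ [p [leg real] <-].
apply: supremum_le => // _ [T _ <-]; rewrite lee_fin lez_nat.
exact: ISOA_mistakes_le isoa Hn leg real.
Qed.

(** * Lower bound by an adversary descending a shattered tree *)

Definition cons_play (x v : X) (y : Y) (p : play X Y) : play X Y :=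
  Play (fun t => if t is t'.+1 then instance p t' else x)
       (fun t => if t is t'.+1 then position p t' else v)
       (fun t => if t is t'.+1 then label p t' else y).

(** The game after round [o] becomes a game of its own, so that induction can pass to a subtree. *)
Definition learner_after (L : learner X Y) (o : X * feedback X Y) :
  learner X Y := fun r => L (o :: r).

Lemma past_cons_play L x v y p t :
  let o := (x, give_feedback (L [::] x) v y) in
  past L (cons_play x v y p) t.+1 = o :: past (learner_after L o) p t.
Proof.
move=> o; elim: t => [//|t IH].
by rewrite [LHS]/= -/(past _ _ t.+1) IH [RHS]/= /learner_after.
Qed.

Lemma consistent_play (L : learner X Y) (h : X -> Y) (x : X) :
  exists p, legal E L p /\ forall t, h (position p t) = label p t.
Proof.
have /choice [f fP] := fun g => best_response_exists g x.
(* Positions depend on hypotheses, which depend on earlier positions; the history is therefore built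
   first and the positions are read off it. *)
pose hist := fix hist t : history X Y := if t is t'.+1 then
  rcons (hist t') (x, give_feedback (L (hist t') x) (f (L (hist t') x))
                       (h (f (L (hist t') x)))) else [::].
pose v t := f (L (hist t) x).
exists (Play (fun=> x) v (h \o v)); split=> // t.
have pastE : past L (Play (fun=> x) v (h \o v)) t = hist t.
  by elim: t => [//|t IH]; rewrite /= IH.
by rewrite /hyp pastE; exact: fP.
Qed.

(** Of two labels at [v], one differs from [g v]. A single label z_1 occurs only at [v] other than
    [x], and an agent that moved there has [g v] above [g x], hence above z_1. *)
Lemma best_response_mistake (g : X -> Y) x v out :
  node_labels E x out -> best_response E g x v -> exists2 y, out v y & g v != y.
Proof.
have two y1 y2 : y1 <> y2 -> out v = [set y1; y2] -> exists2 y, out v y & g v != y.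
  move=> y12 ->; have [gy1|] := eqVneq (g v) y1; last by exists y1 => //; left.
  by exists y2; [right | rewrite gy1; exact/eqP].
move=> [[y1 [y2 [y12 outx]]] outv _] [stay move_].
have [better|/stay vx] := pselect (exists2 u, nbhd E x u & (g x < g u)%O); last first.
  by apply: two y12 _; rewrite vx.
have [xv vmax] := move_ better; case: better => u /vmax uv xu.
have gv := lt_le_trans xu uv.
have vx : v <> x by move=> vx; rewrite vx ltxx in gv.
case: (outv v xv vx) => [outb|[y3 [y4 [_ _ y34 out34]]]]; last exact: two y34 out34.
exists (\bot)%O; first by rewrite outb.
by rewrite -lt0x; exact: le_lt_trans gv.
Qed.

(* Descending the tree, each round presents the label of the current node and
   selects an edge contradicting the learner; below the leaf the play goes on
   forever with labels given by a hypothesis consistent with the branch. *)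
Lemma adversary_play (t : tree X Y) (x0 : X) : is_ilt E t -> forall V L,
  shattered V t -> exists h p s,
  [/\ branch t s, V h, legal E L p, forall i, h (position p i) = label p i
    & forall i, (i < size s)%N -> mistake L p i].
Proof.
elim=> [|x out c outx outv out0 _ IH] V L Vt.
  have [h Vh _] := Vt _ (branch_leaf X Y).
  have [p [leg hp]] := consistent_play L h x0.
  by exists h, p, [::]; split=> //; exact: branch_leaf.
have [v br] := best_response_exists (L [::] x) x.
have [y vy mis] := best_response_mistake (And3 outx outv out0) br.
pose o := (x, give_feedback (L [::] x) v y).
have sub : shattered (restrict V v y) (c v y).
  move=> s /(branch_node x vy) /Vt [h Vh /= /andP[/eqP hv hs]].
  by exists h.
(* Restricting the class to [h v = y] makes the hypothesis found below also consistent with the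
   present round. *)
have [h [p [s [sb [Vh hv] leg hp smis]]]] :=
  IH v y vy _ (learner_after L o) sub.
have hypS i : hyp L (cons_play x v y p) i.+1 = hyp (learner_after L o) p i.
  by rewrite /hyp past_cons_play.
exists h, (cons_play x v y p), ((v, y) :: s); split=> //.
- exact: branch_node.
- by case=> [//|i]; rewrite hypS; exact: leg.
- by case.
- by case=> [//|i] /smis; rewrite /mistake hypS.
Qed.

Lemma worst_case_ge0 (H : set (X -> Y)) L : (0 <= worst_case E H L)%E.
Proof.
rewrite /worst_case; set B := (image _ _).
have [->|/set0P [_ [p pP _]]] := eqVneq B set0; first by rewrite supremum0.
apply: (@le_trans _ _ (nb_mistakes L p)); last by apply: le_supremum; exists p.
by apply: le_supremum; exists 0%N; rewrite ?big_ord0.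
Qed.

Lemma ILdim_le_worst_case (H : set (X -> Y)) L : (ILdim E H <= worst_case E H L)%E.
Proof.
apply: supremum_le => [|_ [n [t [tE Ht [_ tn]]] <-]].
  exact: le_trans (worst_case_ge0 H L).
(* A leaf supplies no instance to present, but its depth 0 is a trivial bound; otherwise the root
   label serves as filler instance. *)
case: t tE Ht tn => [|x0 out c] tE Ht tn.
  have := tn _ (branch_leaf X Y); rewrite leqn0 => /eqP ->.
  exact: worst_case_ge0.
have [h [p [s [/tn sn Hh leg hp smis]]]] := adversary_play x0 tE L Ht.
apply: (@le_trans _ _ (nb_mistakes L p)); last first.
  by apply: le_supremum; exists p => //; split=> //; exists h.
apply: (@le_trans _ _ (size s)%:Z%:E); first by rewrite lee_fin lez_nat.
apply: le_supremum; exists (size s) => //.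
rewrite (eq_bigr (fun=> 1%N)) ?sum1_card ?card_ord // => i _.
by rewrite smis.
Qed.

End Agent.

Theorem theorem2 (X : Type) (d : Order.disp_t) (Y : finTBOrderType d)
    (E : set (X * X)) (H : set (X -> Y)) :
  (forall x : X, E (x, x)) ->
  (exists h : X -> Y, H h) ->
  [/\ optimal_mistakes E H = ILdim E H,
      exists L : learner X Y, multiclass_ISOA E H L
    & forall L : learner X Y, multiclass_ISOA E H L ->
        worst_case E H L = optimal_mistakes E H].
Proof.
move=> Exx H0.
(* The two bounds meet at every implementation, so the infimum over learners is a minimum. *)
have isoaE L : multiclass_ISOA E H L -> worst_case E H L = ILdim E H.
  move=> isoa; apply/eqP; rewrite eq_le ILdim_le_worst_case // andbT.
  exact: worst_case_ISOA_le.
have [L0 isoa0] := multiclass_ISOA_exists E H.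
have optE : optimal_mistakes E H = ILdim E H.
  apply: infimum_min; first by exists L0 => //; exact: isoaE.
  by move=> _ [L _ <-]; exact: ILdim_le_worst_case.
by split=> [//||L /isoaE ->//]; exists L0.
Qed.
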